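(* Let $Q$ be a finite quiver with vertex set $I$, let $\Theta\in(\mathbf{Q}I)^*$ be a stability condition with slope function $\mu$, let $d,n\in\mathbf{N}I$ be nonzero dimension vectors, and let $(\hat Q,\hat d,\hat\Theta)$ be the associated framed datum, with slope function $\hat\mu$. View a complex representation of $\hat Q$ of dimension vector $\hat d$ as a pair $(M,f)$, where $M$ is a representation of $Q$ of dimension vector $d$ and $f=(f_i:V_i\to M_i)_{i\in I}$ is a tuple of linear maps. Then the following are equivalent: (a) $(M,f)$ is $\hat\mu$-semistable; (b) $(M,f)$ is $\hat\mu$-stable; (c) $M$ is a $\mu$-semistable representation of $Q$, and $\mu(U)<\mu(M)$ for all proper subrepresentations $U$ of $M$ containing the image of $f$ (that is, $f_i(V_i)\subset U_i$ for all $i\in I$).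
   Context: All representations are finite-dimensional and over $\mathbf{C}$. Elements of $\mathbf{N}I$ are dimension vectors $d=\sum_{i\in I}d_i i$. Put $\dim d=\sum_{i}d_i$ and $\mu(d)=\Theta(d)/\dim d\in\mathbf{Q}$ for $d\ne0$; the slope $\mu(X)$ of a representation $X$ is the slope of its dimension vector. A representation $X$ is $\mu$-semistable (resp. $\mu$-stable) if $\mu(U)\le\mu(X)$ (resp. $\mu(U)<\mu(X)$) for all nonzero proper subrepresentations $U$ of $X$. The same definitions are used for $\hat Q$ with $\hat\Theta$, giving $\hat\mu$. Framed datum: the vertices of $\hat Q$ are those of $Q$ together with one additional vertex $\infty$; the arrows of $\hat Q$ are those of $Q$ together with $n_i$ arrows from $\infty$ to $i$ for every $i\in I$; $\hat d_i=d_i$ for $i\in I$ and $\hat d_\infty=1$; $\hat\Theta_i=\Theta_i$ for $i\in I$ and $\hat\Theta_\infty=\mu(d)+\varepsilon$ for some sufficiently small positive $\varepsilon\in\mathbf{Q}$. Fix vector spaces $V_i$ of dimension $n_i$ with a basis; the $n_i$ arrows $\infty\to i$ are represented by $n_i$ vectors of $M_i$ (since $\hat d_\infty=1$), i.e. by a linear map $f_i:V_i\to M_i$.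
   Formalization: In (c), when f = 0 the proper subrepresentation U = 0 contains the image of f but its slope is undefined; (c) is read as requiring U to be nonzero and μ(U) < μ(M), so (c) fails when f = 0. *)

(* Defs.v *)
From HB Require Import structures.
From mathcomp Require Import all_boot all_order all_algebra.

Set Implicit Arguments.
Unset Strict Implicit.
Unset Printing Implicit Defensive.

Import Order.TTheory GRing.Theory Num.Theory.
Local Open Scope ring_scope.

Record quiver := Quiver {
  vertex :> finType;
  arrow : finType;
  src : arrow -> vertex;
  tgt : arrow -> vertex }.

Record rep (F : fieldType) (Q : quiver) := Rep {
  rep_space :> Q -> vectType F;
  rep_map : forall a : arrow Q, 'Hom(rep_space (src a), rep_space (tgt a)) }.

Record subrep (F : fieldType) (Q : quiver) (X : rep F Q) := SubRep {
  sub_space :> forall i : Q, {vspace X i};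
  sub_stable : forall a : arrow Q,
    (rep_map X a @: sub_space (src a) <= sub_space (tgt a))%VS }.

Definition subrep_nonzero (F : fieldType) (Q : quiver) (X : rep F Q)
    (U : subrep X) : Prop := exists i : Q, U i <> 0%VS.

Definition subrep_proper (F : fieldType) (Q : quiver) (X : rep F Q)
    (U : subrep X) : Prop := exists i : Q, U i <> fullv.

Definition dimvec (F : fieldType) (Q : quiver) (X : rep F Q) : {ffun Q -> nat} :=
  [ffun i => \dim {: X i}].

Definition sub_dimvec (F : fieldType) (Q : quiver) (X : rep F Q) (U : subrep X) :
  {ffun Q -> nat} := [ffun i => \dim (U i)].

(* A functional Theta in (QI)^* is given by its values Theta_i on the basis I;
   Theta(d) = \sum_i Theta_i d_i.  The slope is meaningful for d != 0 only: at
   d = 0 it takes the junk value 0 / 0 = 0, so an inequality mu(U) < mu(M) for a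
   subrepresentation U that may be 0 has to be paired with [subrep_nonzero U]. *)
Definition slope (I : finType) (Theta : {ffun I -> rat}) (d : {ffun I -> nat}) :
  rat := (\sum_i Theta i * (d i)%:R) / (\sum_i d i)%N%:R.

Definition semistable (F : fieldType) (Q : quiver) (Theta : {ffun Q -> rat})
    (X : rep F Q) : Prop :=
  forall U : subrep X, subrep_nonzero U -> subrep_proper U ->
    slope Theta (sub_dimvec U) <= slope Theta (dimvec X).

Definition stable (F : fieldType) (Q : quiver) (Theta : {ffun Q -> rat})
    (X : rep F Q) : Prop :=
  forall U : subrep X, subrep_nonzero U -> subrep_proper U ->
    slope Theta (sub_dimvec U) < slope Theta (dimvec X).

(* The additional vertex is [None]; the arrow [inr (Tagged _ k)] with
   k : 'I_(n i) is the k-th arrow from it to i. *)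
Definition framed_quiver (Q : quiver) (n : {ffun Q -> nat}) : quiver :=
  @Quiver (option Q) (arrow Q + {i : Q & 'I_(n i)})%type
    (fun a => match a with inl b => Some (src b) | inr _ => None end)
    (fun a => match a with inl b => Some (tgt b) | inr k => Some (tag k) end).

Definition framed_dim (Q : quiver) (n d : {ffun Q -> nat}) :
    {ffun framed_quiver n -> nat} :=
  [ffun v : option Q => if v is Some i then d i else 1%N].

Definition framed_stab (Q : quiver) (Theta : {ffun Q -> rat})
    (n d : {ffun Q -> nat}) (eps : rat) : {ffun framed_quiver n -> rat} :=
  [ffun v : option Q => if v is Some i then Theta i else slope Theta d + eps].

Definition scale_vec (F : fieldType) (W : vectType F) (w : W) (z : F^o) : W :=
  z *: w.

Fact scale_vec_is_linear (F : fieldType) (W : vectType F) (w : W) :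
  linear (scale_vec w).
Proof. by move=> a x y; rewrite /scale_vec scalerDl scalerA. Qed.

HB.instance Definition _ (F : fieldType) (W : vectType F) (w : W) :=
  GRing.isLinear.Build F F^o W *:%R (scale_vec w) (scale_vec_is_linear w).

Section FramedRep.
Variables (F : fieldType) (Q : quiver) (n : {ffun Q -> nat}).
Variables (V : Q -> vectType F) (b : forall i : Q, (n i).-tuple (V i)).
Variables (M : rep F Q) (f : forall i : Q, 'Hom(V i, M i)).

Definition framed_space (v : framed_quiver n) : vectType F :=
  match v with Some i => M i | None => F^o end.

(* The k-th arrow from the additional vertex to i sends 1 to the vector
   f_i(b_k) of M_i, where b is the chosen basis of V_i. *)
Definition framed_map (a : arrow (framed_quiver n)) :
    'Hom(framed_space (src a), framed_space (tgt a)) :=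
  match a with
  | inl c => rep_map M c
  | inr k => linfun (scale_vec (f (tag k) (tnth (b (tag k)) (tagged k))))
  end.

Definition framed_rep : rep F (framed_quiver n) := Rep framed_map.

Lemma dimvec_framed_rep : dimvec framed_rep = framed_dim n (dimvec M).
Proof.
apply/ffunP => -[i|]; rewrite !ffunE //=.
by rewrite dimvf.
Qed.

Lemma framed_mapE (k : {i : Q & 'I_(n i)}) (z : F) :
  rep_map framed_rep (inr k) z = z *: f (tag k) (tnth (b (tag k)) (tagged k)).
Proof. by rewrite lfunE. Qed.

End FramedRep.

(* Main.v *)
Require Import Defs.
From mathcomp Require Import all_boot all_order all_algebra.
From mathcomp Require Import reals complex.
From mathcomp Require Import ring lra.

Set Implicit Arguments.
Unset Strict Implicit.
Unset Printing Implicit Defensive.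

Import Order.TTheory GRing.Theory Num.Theory.
Local Open Scope ring_scope.

(* Put theta(e) = sum_i (Theta_i - mu(d)) e_i; for e <> 0 its sign is that of
   mu(e) - mu(d).  The values of theta are integral multiples of 1/N, where N is
   a common denominator of its coefficients, so eps < 1/N cannot change a nonzero
   sign.  A subrepresentation of the framed representation has dimension (e, 0),
   and then comes from any U <= M of dimension e, or (e, 1), and then U contains
   the image of f.  Comparing its slope with mu(d) + eps / (dim d + 1) amounts to
   comparing theta(e) - eps dim e / (dim d + 1) with 0 in the first case, and
   theta(e) + eps (dim d - dim e) / (dim d + 1) with 0 in the second.  Both
   shifts lie strictly between 0 and 1/N in absolute value, so weak and strict
   inequalities agree, and they mean theta(e) <= 0 and theta(e) < 0 respectively. *)

(** * Slopes as signs of linear functionals, and the integrality gap *)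

Definition excess (I : finType) (Theta : I -> rat) (m : rat) (e : I -> nat) : rat :=
  \sum_i (Theta i - m) * (e i)%:R.

Lemma linear_gap (I : finType) (t : I -> rat) :
  exists2 gap : rat, 0 < gap &
    forall e : I -> nat, `|\sum_i t i * (e i)%:R| < gap ->
      \sum_i t i * (e i)%:R = 0.
Proof.
pose N : rat := \prod_i (denq (t i))%:~R.
have N_gt0 : 0 < N by apply: prodr_gt0 => i _; rewrite ltr0z denq_gt0.
exists N^-1 => [|e]; first by rewrite invr_gt0.
set S := (X in `|X|) => ltS; apply/eqP; apply: contraTT ltS => S_neq0.
have intNS : N * S \is a Num.int.
  rewrite mulr_sumr rpred_sum// => i _; rewrite mulrA rpredM ?rpred_nat//.
  (* The factor of [N] at [i] turns [t i] into its numerator; the other factors are integers. *)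
  rewrite /N (bigD1 i)//= mulrAC [_ * t i]mulrC -numqE rpredM ?rpred_int//.
  by rewrite rpred_prod// => j _; rewrite rpred_int.
rewrite -leNgt -[leLHS]mulr1 ler_pdivrMl// -[X in X * _](gtr0_norm N_gt0) -normrM.
by rewrite norm_intr_ge1// mulf_neq0// gt_eqF.
Qed.

(** Moves the base point between the slope of [d], where the gap is known, and the framed slope,
    where the comparison takes place. *)
Lemma excessD (I : finType) (Theta : I -> rat) (m c : rat) (e : I -> nat) :
  excess Theta (m + c) e = excess Theta m e - c * (\sum_i e i)%N%:R.
Proof.
rewrite /excess natr_sum mulr_sumr -sumrB; apply: eq_bigr => i _.
by rewrite opprD addrA mulrBl.
Qed.

Lemma slopeB (I : finType) (Theta : {ffun I -> rat}) (m : rat) (e : {ffun I -> nat}) :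
  (0 < \sum_i e i)%N ->
  slope Theta e - m = excess Theta m e / (\sum_i e i)%N%:R.
Proof.
move=> e_gt0; have e_neq0 : (\sum_i e i)%N%:R != 0 :> rat by rewrite pnatr_eq0 -lt0n.
rewrite -[in excess _ m _](add0r m) excessD mulrBl mulfK//; congr (_ / _ - _).
by apply: eq_bigr => i _; rewrite subr0.
Qed.

Lemma slope_le (I : finType) (Theta : {ffun I -> rat}) (m : rat) (e : {ffun I -> nat}) :
  (0 < \sum_i e i)%N -> (slope Theta e <= m) = (excess Theta m e <= 0).
Proof. by move=> e0; rewrite -subr_le0 slopeB// pmulr_lle0// invr_gt0 ltr0n. Qed.

Lemma slope_lt (I : finType) (Theta : {ffun I -> rat}) (m : rat) (e : {ffun I -> nat}) :
  (0 < \sum_i e i)%N -> (slope Theta e < m) = (excess Theta m e < 0).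
Proof. by move=> e0; rewrite -subr_lt0 slopeB// pmulr_llt0// invr_gt0 ltr0n. Qed.

Lemma big_option (T : Type) (idx : T) (op : Monoid.com_law idx) (I : finType)
    (F : option I -> T) :
  \big[op/idx]_v F v = op (F None) (\big[op/idx]_i F (Some i)).
Proof.
rewrite (bigD1 None)//=; congr (op _ _).
rewrite (reindex_omap Some id) => [|[]//].
by apply: eq_bigl => i; rewrite eqxx.
Qed.

Lemma gap_cases (F : realFieldType) (gap t : F) :
  (`|t| < gap -> t = 0) -> t = 0 \/ gap <= t \/ t <= - gap.
Proof.
move=> t_gap; have [/t_gap|] := ltP `|t| gap; first by left.
by rewrite ler_normr lerNr => /orP; right.
Qed.

(** At [t = 0] the shifted value is strictly negative, and a shift below [gap] cannot bring
    [t >= gap] down to 0. *)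
Lemma gap_subr (F : realFieldType) (gap x t : F) :
    (`|t| < gap -> t = 0) -> 0 < x -> x < gap ->
  (t - x <= 0) = (t <= 0) /\ (t - x < 0) = (t <= 0).
Proof.
by move=> /gap_cases[|[]] ? ? ?; split; apply/idP/idP => ?; lra.
Qed.

(** Here the case [t = 0] falls on the positive side, which makes the condition on [t] strict. *)
Lemma gap_addr (F : realFieldType) (gap x t : F) :
    (`|t| < gap -> t = 0) -> 0 < x -> x < gap ->
  (t + x <= 0) = (t < 0) /\ (t + x < 0) = (t < 0).
Proof.
by move=> /gap_cases[|[]] ? ? ?; split; apply/idP/idP => ?; lra.
Qed.

(** * Slope comparisons for the framed datum *)

Section FramedSlope.
Variables (Q : quiver) (Theta : {ffun Q -> rat}) (n d : {ffun Q -> nat}) (eps : rat).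
Hypothesis d_gt0 : (0 < \sum_i d i)%N.

Let D := (\sum_i d i)%N.
Let fTheta := framed_stab Theta n d eps.
Let fslope := slope fTheta (framed_dim n d).
Let theta (e : Q -> nat) := excess Theta (slope Theta d) e.

Lemma sum_framed (e : framed_quiver n -> nat) :
  (\sum_v e v = e None + \sum_(i : Q) e (Some i))%N.
Proof. exact: big_option. Qed.

Lemma excess_framed (m : rat) (e : framed_quiver n -> nat) :
  excess fTheta m e = (slope Theta d + eps - m) * (e None)%:R
    + excess Theta m (fun i => e (Some i)).
Proof.
rewrite /excess (@big_option _ _ _ Q) /= /fTheta !ffunE.
by congr (_ + _); apply: eq_bigr => i _; rewrite ffunE.
Qed.

Lemma excess_slope : theta d = 0.
Proof.
have := slopeB Theta (slope Theta d) d_gt0; rewrite subrr => /esym/eqP.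
by rewrite mulf_eq0 invr_eq0 pnatr_eq0 (gtn_eqF d_gt0) orbF => /eqP.
Qed.

(** Since [theta] vanishes on [d], only the additional vertex contributes: its surplus [eps] is
    averaged over total dimension [D.+1]. *)
Lemma slope_framed : fslope = slope Theta d + eps / D.+1%:R.
Proof.
have D1 : D.+1%:R != 0 :> rat by rewrite pnatr_eq0.
have framedE : (fun i => framed_dim n d (Some i)) =1 d by move=> i; rewrite ffunE.
have sumE : (\sum_v framed_dim n d v = D.+1)%N.
  by rewrite sum_framed ffunE add1n (eq_bigr d).
apply/eqP; rewrite -subr_eq0 slopeB ?sumE// mulf_eq0; apply/orP; left.
rewrite excess_framed excessD ffunE (eq_bigr d)// -/D.
rewrite [excess _ _ _](eq_bigr (fun i => (Theta i - slope Theta d) * (d i)%:R)).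
  rewrite [X in _ + (X - _)]excess_slope; apply/eqP.
  by move: D1; rewrite -natr1 => D1; field.
by move=> i _; rewrite framedE.
Qed.

Variable gap : rat.
Hypothesis theta_gap : forall e, `|theta e| < gap -> theta e = 0.
Hypotheses (eps_gt0 : 0 < eps) (eps_lt : eps < gap).

(** The bound by [D] is weak because [e' = d] occurs: all of M, with 0 at the additional vertex, is
    a proper subrepresentation of the framed one. *)
Lemma slope_framed_without (e : {ffun framed_quiver n -> nat}) (e' : {ffun Q -> nat}) :
    (forall i : Q, e (Some i) = e' i) -> e None = 0%N -> (0 < \sum_i e' i <= D)%N ->
  (slope fTheta e <= fslope) = (slope Theta e' <= slope Theta d) /\
  (slope fTheta e < fslope) = (slope Theta e' <= slope Theta d).
Proof.
move=> ee' e0 /andP[se_gt0 se_le].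
have sumE : (\sum_v e v = \sum_i e' i)%N by rewrite sum_framed e0; apply: eq_bigr.
rewrite slope_le ?slope_lt ?sumE// slope_le//.
rewrite excess_framed e0 mulr0 add0r.
rewrite [excess _ _ _](_ : _ = excess Theta fslope e'); last first.
  by apply: eq_bigr => i _; rewrite ee'.
rewrite slope_framed excessD.
apply: gap_subr (theta_gap (e := e')) _ _.
  by rewrite !mulr_gt0 ?invr_gt0 ?ltr0n.
apply: le_lt_trans eps_lt; rewrite mulrAC ler_pdivrMr ?ltr0n// ler_pM2l//.
by rewrite ler_nat ltnW.
Qed.

(** The bound by [D] is strict so that the shift is positive. Positivity of the dimension is part of
    [compat] because the junk slope 0 of [e' = 0] could be below that of [d]. *)
Lemma slope_framed_with (e : {ffun framed_quiver n -> nat}) (e' : {ffun Q -> nat}) :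
    (forall i : Q, e (Some i) = e' i) -> e None = 1%N -> (\sum_i e' i < D)%N ->
  let compat := (0 < \sum_i e' i)%N && (slope Theta e' < slope Theta d) in
  (slope fTheta e <= fslope) = compat /\ (slope fTheta e < fslope) = compat.
Proof.
move=> ee' e1 se_lt compat.
have sumE : (\sum_v e v = (\sum_i e' i).+1)%N.
  by rewrite sum_framed e1 add1n; congr S; apply: eq_bigr.
have -> : compat = (theta e' < 0).
  rewrite /compat; have [se0|se_gt0] := posnP (\sum_i e' i)%N; last exact: slope_lt.
  (* For [e' = 0] both sides are false, as [theta] is then 0. *)
  rewrite /theta /excess big1 ?ltxx// => i _.
  by move/eqP: se0; rewrite sum_nat_eq0 => /forallP/(_ i)/eqP->; rewrite mulr0.
rewrite slope_le ?slope_lt ?sumE//.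
rewrite excess_framed e1 mulr1.
rewrite [excess _ _ _](_ : _ = excess Theta fslope e'); last first.
  by apply: eq_bigr => i _; rewrite ee'.
rewrite slope_framed excessD -/(theta e').
set y := (\sum_i _)%N in se_lt *.
have -> : slope Theta d + eps - (slope Theta d + eps / D.+1%:R)
    + (theta e' - eps / D.+1%:R * y%:R) = theta e' + eps * (D%:R - y%:R) / D.+1%:R.
  have : D.+1%:R != 0 :> rat by rewrite pnatr_eq0.
  by rewrite -natr1 => D1; field.
apply: gap_addr (theta_gap (e := e')) _ _.
  by rewrite divr_gt0 ?ltr0n// mulr_gt0// subr_gt0 ltr_nat.
apply: le_lt_trans eps_lt; rewrite ler_pdivrMr ?ltr0n// ler_pM2l// lerBlDr.
by rewrite -natrD ler_nat (leq_trans (leqnSn D))// leq_addr.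
Qed.

End FramedSlope.

(** * Subrepresentations of a framed representation *)

Lemma subrep_nonzeroP (F : fieldType) (Q : quiver) (X : rep F Q) (U : subrep X) :
  subrep_nonzero U <-> (0 < \sum_i sub_dimvec U i)%N.
Proof.
rewrite lt0n sum_nat_eq0 negb_forall; split.
  by case=> i /eqP Ui; apply/existsP; exists i; rewrite ffunE dimv_eq0.
by case/existsP=> i; rewrite ffunE dimv_eq0 => /eqP Ui; exists i.
Qed.

Lemma sub_dimvec_le (F : fieldType) (Q : quiver) (X : rep F Q) (U : subrep X) :
  (\sum_i sub_dimvec U i <= \sum_i dimvec X i)%N.
Proof. by apply: leq_sum => i _; rewrite !ffunE dimvS// subvf. Qed.

Lemma subrep_properP (F : fieldType) (Q : quiver) (X : rep F Q) (U : subrep X) :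
  subrep_proper U <-> (\sum_i sub_dimvec U i < \sum_i dimvec X i)%N.
Proof.
have le_dim i : (sub_dimvec U i <= dimvec X i)%N by rewrite !ffunE dimvS// subvf.
split=> [[i /eqP Ui]|lt_dim].
  rewrite (bigD1 i)// [ltnRHS](bigD1 i)//= -addSn leq_add ?leq_sum//.
  by rewrite !ffunE ltn_neqAle dimvS ?subvf// andbT dimv_leqif_eq ?subvf// Ui.
have [|/existsPn full] := boolP [exists i, U i != fullv].
  by case/existsP=> i /eqP; exists i.
move: lt_dim; rewrite ltnNge leq_sum// => i _.
by have /negPn/eqP Ui := full i; rewrite !ffunE Ui.
Qed.

Section FramedSubrep.
Variables (F : fieldType) (Q : quiver) (n : {ffun Q -> nat}).
Variables (V : Q -> vectType F) (b : forall i : Q, (n i).-tuple (V i)).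
Hypothesis b_basis : forall i : Q, basis_of fullv (b i).
Variables (M : rep F Q) (f : forall i : Q, 'Hom(V i, M i)).
Let X := framed_rep b f.

Definition extend_space (U : subrep M) (W : {vspace F^o}) (v : framed_quiver n) :
    {vspace X v} :=
  match v with Some i => U i | None => W end.

(** Only the arrows out of the additional vertex impose a new condition: it is void for [W = 0], and
    otherwise follows from U containing the image of [f]. *)
Lemma extend_subrep (U : subrep M) (W : {vspace F^o}) :
    W = 0%VS \/ (forall i : Q, (limg (f i) <= U i)%VS) ->
  exists U' : subrep X,
    U' None = W :> {vspace F^o} /\ forall i : Q, U' (Some i) = U i.
Proof.
move=> fU; suff stab a : (rep_map X a @: extend_space U W (src a)
    <= extend_space U W (tgt a))%VS by exists (SubRep stab).
case: a => [a|k] /=; first exact: sub_stable.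
case: fU => [->|fU]; first by rewrite limg0 sub0v.
apply/subvP => _ /memv_imgP[z _ ->]; rewrite framed_mapE.
by rewrite memvZ// (subvP (fU _))// memv_img// memvf.
Qed.

(** The space at the additional vertex is a line, so its subspace is 0 or everything. In the latter
    case stability puts each [f i] of a basis vector in U, and these vectors span the image. *)
Lemma restrict_subrep (U' : subrep X) :
  exists2 U : subrep M, forall i : Q, U' (Some i) = U i &
    U' None = 0%VS \/ U' None = fullv /\ forall i : Q, (limg (f i) <= U i)%VS.
Proof.
have stab a : (rep_map M a @: U' (Some (src a)) <= U' (Some (tgt a)))%VS.
  exact: (sub_stable U' (inl a)).
exists (SubRep (sub_space := fun i => U' (Some i)) stab) => //=.
have [->|U0] := eqVneq (U' None) 0%VS; [by left | right].
have Ufull : U' None = fullv.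
  apply/eqP; rewrite eqEdim subvf/= dimvf /= lt0n dimv_eq0.
  exact: U0.
split=> // i; rewrite -(span_basis (b_basis i)) limg_span.
apply/span_subvP => _ /mapP[_ /tnthP[k ->] ->].
set t : {i : Q & 'I_(n i)} := Tagged _ k.
have /subvP := sub_stable U' (inr t); apply.
rewrite -[X in X \in _]scale1r -[X in X \in _](framed_mapE b f t).
by rewrite memv_img//= Ufull memvf.
Qed.

End FramedSubrep.

(** * The equivalence of the three conditions *)

Theorem proposition3p3 (R : realType) (Q : quiver) (Theta : {ffun Q -> rat})
    (d n : {ffun Q -> nat}) (hd : d != 0) (hn : n != 0) :
  exists eps0 : rat, 0 < eps0 /\
    forall eps : rat, 0 < eps -> eps < eps0 ->
    forall (V : Q -> vectType R[i]) (b : forall i : Q, (n i).-tuple (V i))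
      (hb : forall i : Q, basis_of fullv (b i))
      (M : rep R[i] Q) (hM : dimvec M = d) (f : forall i : Q, 'Hom(V i, M i)),
    [<-> semistable (framed_stab Theta n d eps) (framed_rep b f);
         stable (framed_stab Theta n d eps) (framed_rep b f);
         semistable Theta M /\
         (forall U : subrep M, subrep_proper U ->
              (forall i : Q, (limg (f i) <= U i)%VS) ->
            subrep_nonzero U /\ slope Theta (sub_dimvec U) < slope Theta (dimvec M))].
Proof.
have d_gt0 : (0 < \sum_i d i)%N.
  rewrite lt0n; apply: contraNneq hd => /eqP.
  rewrite sum_nat_eq0 => /forallP d0; apply/eqP/ffunP => i.
  by rewrite ffunE; apply/eqP/d0.
have [gap gap_gt0 theta_gap] := linear_gap (fun i => Theta i - slope Theta d).
(* The bound depends on [Theta] and [d] alone, so it is fixed before the representation. *)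
exists gap; split=> // eps eps_gt0 eps_lt V b b_basis M hM f.
have fdimE : dimvec (framed_rep b f) = framed_dim n d.
  by rewrite dimvec_framed_rep hM.
have cmp0 := @slope_framed_without _ _ n _ _ d_gt0 _ theta_gap eps_gt0 eps_lt.
have cmp1 := @slope_framed_with _ _ n _ _ d_gt0 _ theta_gap eps_gt0 eps_lt.
pose c := semistable Theta M /\
  (forall U : subrep M, subrep_proper U ->
     (forall i : Q, (limg (f i) <= U i)%VS) ->
   subrep_nonzero U /\ slope Theta (sub_dimvec U) < slope Theta (dimvec M)).
have ac : semistable (framed_stab Theta n d eps) (framed_rep b f) -> c.
  rewrite /semistable fdimE => ss; split=> [U U0 U1|U U1 fU].
    have [W [W0 WU]] := extend_subrep b (f := f) (U := U) (W := 0%VS) (or_introl erefl).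
    have WdU i : sub_dimvec W (Some i) = sub_dimvec U i by rewrite !ffunE WU.
    have Wd0 : sub_dimvec W None = 0%N by rewrite ffunE W0 dimv0.
    have U_le : (\sum_i sub_dimvec U i <= \sum_i d i)%N by rewrite -hM sub_dimvec_le.
    rewrite hM -(cmp0 _ _ WdU Wd0 _).1 ?U_le ?andbT; last exact/subrep_nonzeroP.
    apply: ss.
      by case: U0 => i Ui; exists (Some i); rewrite WU.
    by case: U1 => i Ui; exists (Some i); rewrite WU.
  (* With the whole line added, W is nonzero even if U is 0; the comparison itself then shows that U
     is nonzero. *)
  have [W [W1 WU]] := extend_subrep b (W := fullv) (or_intror fU).
  have WdU i : sub_dimvec W (Some i) = sub_dimvec U i by rewrite !ffunE WU.
  have Wd1 : sub_dimvec W None = 1%N by rewrite ffunE W1 dimvf.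
  have U_lt : (\sum_i sub_dimvec U i < \sum_i d i)%N.
    by rewrite -hM; apply/subrep_properP.
  have: slope (framed_stab Theta n d eps) (sub_dimvec W)
      <= slope (framed_stab Theta n d eps) (framed_dim n d).
    apply: ss.
      by exists None => W0; move: Wd1; rewrite ffunE W0 dimv0.
    by case: U1 => i Ui; exists (Some i); rewrite WU.
  rewrite (cmp1 _ _ WdU Wd1 U_lt).1 hM => /andP[U_gt0 ->].
  by split=> //; apply/subrep_nonzeroP.
have cb : c -> stable (framed_stab Theta n d eps) (framed_rep b f).
  case=> ss st W W_nz W_pr; rewrite fdimE.
  have [U WU W0f] := restrict_subrep b_basis W.
  have WdU i : sub_dimvec W (Some i) = sub_dimvec U i by rewrite !ffunE WU.
  case: W0f => [W0|[W1 fU]].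
    have Wd0 : sub_dimvec W None = 0%N by rewrite ffunE W0 dimv0.
    have U_nz : subrep_nonzero U.
      by case: W_nz => -[i|//]; rewrite WU; exists i.
    have U_le : (\sum_i sub_dimvec U i <= \sum_i d i)%N by rewrite -hM sub_dimvec_le.
    rewrite (cmp0 _ _ WdU Wd0 _).2 ?U_le ?andbT; last exact/subrep_nonzeroP.
    (* U may be all of M, where semistability of M says nothing; the two slopes are then equal. *)
    have [U_full|U_prop] := leqP (\sum_i dimvec M i) (\sum_i sub_dimvec U i).
      have -> : sub_dimvec U = d; last exact: lexx.
      apply/ffunP => i; rewrite -hM !ffunE.
      case: (eqVneq (U i) fullv) => [->//|/eqP Ui].
      have : subrep_proper U by exists i.
      by move/subrep_properP; rewrite ltnNge U_full.
    by rewrite -hM; apply: ss => //; apply/subrep_properP.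
  have Wd1 : sub_dimvec W None = 1%N by rewrite ffunE W1 dimvf.
  have U_pr : subrep_proper U.
    (* W is full at the additional vertex, so it fails to be full at a vertex of Q. *)
    by case: W_pr => -[i|//]; rewrite WU; exists i.
  have U_lt : (\sum_i sub_dimvec U i < \sum_i d i)%N.
    by rewrite -hM; apply/subrep_properP.
  rewrite (cmp1 _ _ WdU Wd1 U_lt).2 -hM.
  by have [/subrep_nonzeroP-> ->] := st U U_pr fU.
tfae=> [/ac/cb//||].
- move=> st; apply: ac => U U_nz U_pr; exact/ltW/st.
- by move=> /cb st U U_nz U_pr; apply/ltW/st.
Qed.
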